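(* Let $x_1^*,\dots,x_M^*$ be consecutive waypoints on a safe trajectory (demonstration) $\xi^*$ at times $t_1,\dots,t_M$, with time discretization $\Delta t_i$ between states $x_i^*$ and $x_{i+1}^*$ (so $t_{i+1}=t_i+\Delta t_i$), where all waypoints but $x_1^*$ and $x_M^*$ are free to move. Then a necessary condition for being able to sample unsafe trajectories is that there exist $$x_2\in\mathrm{FRS}(x_1^*,\mathcal{U},t_1,t_1+\Delta t_1),\ \dots,\ x_{M-1}\in\mathrm{FRS}(x_{M-2},\mathcal{U},t_{M-2},t_{M-2}+\Delta t_{M-2})$$ with $$x_M^*\in\mathrm{FRS}(x_{M-1},\mathcal{U},t_{M-1},t_{M-1}+\Delta t_{M-1})$$ such that $x_i\ne x_i^*$ for some $i\in\{2,\dots,M-1\}$; i.e. there exists at least one state that the dynamics allow to be moved from the demonstrated trajectory.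
   Context: Setting. The state space is $\mathcal{X}$, the control set is $\mathcal{U}$, and the system is a dynamical system with control constraints $u(t)\in\mathcal{U}$. There is an unknown unsafe set $\mathcal{A}\subseteq\mathcal{X}$; a trajectory is safe iff none of its states lies in $\mathcal{A}$. The demonstration $\xi^*$ is a cost-minimizing trajectory, for some cost function, among the trajectories that are safe and satisfy the known constraints (dynamics, control constraints, start and goal states). Sampling. Trajectories are represented by their waypoints at the discretization times. Being able to sample unsafe trajectories means that there is a trajectory that satisfies the dynamics and control constraints, agrees with $\xi^*$ except that the waypoints at times $t_2,\dots,t_{M-1}$ may be changed (in particular it passes through $x_1^*$ at $t_1$ and $x_M^*$ at $t_M$), and has strictly lower cost than $\xi^*$. Such a trajectory necessarily has a state in $\mathcal{A}$, hence is unsafe. Forward reachable set. $\mathrm{FRS}(x_s,\mathcal{U},T_1,T_2)$ is the set of all states the dynamical system can reach at time $T_2$ starting from $x_s$ at time $T_1$ using controls in $\mathcal{U}$: $$\mathrm{FRS}(x_s,\mathcal{U},T_1,T_2)\doteq\{z\in\mathcal{X}\ |\ \exists\,u:[T_1,T_2]\to\mathcal{U},\ x_{T_1}=x_s,\ x_{T_2}=z\},$$ where $x_t$ denotes the state at time $t$ of the system driven by $u$. *)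

(* Defs.v *)
From mathcomp Require Import all_boot all_order all_algebra.
From mathcomp Require Import boolp classical_sets reals.

Set Implicit Arguments.
Unset Strict Implicit.
Unset Printing Implicit Defensive.

Import Order.TTheory GRing.Theory Num.Theory.
Local Open Scope classical_set_scope.
Local Open Scope ring_scope.

(* A deterministic, possibly time-varying control system, given by its
   transition map as in Sontag's "Mathematical Control Theory":
   [transition s t x u] is the state at time t of the system started in x at
   time s and driven by u, or [None] when u does not drive the system from x up
   to time t (u not admissible, no solution up to t, ...).  The time set T is the
   reals for continuous-time systems and the integers for discrete-time ones.
   Controls are total functions, of which only the values on [s, t) matter. *)
Record control_system (T : realDomainType) (X V : Type) := ControlSystem {
  transition : T -> T -> X -> (T -> V) -> option X;
  transition_local : forall s t x (u v : T -> V), s <= t ->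
    (forall r, s <= r < t -> u r = v r) ->
    transition s t x u = transition s t x v;
  transition_refl : forall s x u, transition s s x u = Some x;
  transition_trans : forall s r t x u, s <= r -> r <= t ->
    transition s t x u =
      obind (fun y => transition r t y u) (transition s r x u)
}.

Section Systems.
Variables (T : realDomainType) (X V : Type).
Variables (Sigma : control_system T X V).

Definition FRS (xs : X) (U : set V) (T1 T2 : T) : set X :=
  [set z | exists u : T -> V,
     (forall s, T1 <= s <= T2 -> U (u s)) /\
     transition Sigma T1 T2 xs u = Some z].

(* A trajectory is the family of its waypoints xi 0, ..., xi N at the
   discretization times tau 0, ..., tau N. *)

Definition feasible (U : set V) (N : nat) (tau : 'I_N.+1 -> T)
    (xi : 'I_N.+1 -> X) : Prop :=
  exists u : T -> V,
    (forall s, tau ord0 <= s <= tau ord_max -> U (u s)) /\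
    forall j, transition Sigma (tau ord0) (tau j) (xi ord0) u = Some (xi j).

Definition known_constraints (U : set V) (N : nat) (tau : 'I_N.+1 -> T)
    (x_start x_goal : X) (xi : 'I_N.+1 -> X) : Prop :=
  [/\ feasible U tau xi, xi ord0 = x_start & xi ord_max = x_goal].

Definition safe (A : set X) (N : nat) (xi : 'I_N.+1 -> X) : Prop :=
  forall j, ~ A (xi j).

Definition demonstration (R : realType) (U : set V) (A : set X) (N : nat)
    (tau : 'I_N.+1 -> T) (x_start x_goal : X) (cost : ('I_N.+1 -> X) -> R)
    (xi : 'I_N.+1 -> X) : Prop :=
  [/\ known_constraints U tau x_start x_goal xi,
      safe A xi
    & forall xi', known_constraints U tau x_start x_goal xi' -> safe A xi' ->
        cost xi <= cost xi'].

(* The position in the whole trajectory of the i-th waypoint, i = 1, 2, ..., of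
   a block of consecutive waypoints that starts at position k.  Meaningful only
   when k + i.-1 <= N. *)
Definition block_index (N k i : nat) : 'I_N.+1 := inord (k + i.-1).

(* The sampled trajectory is required to be cheaper than xi, not to be unsafe:
   see [lower_cost_unsafe]. *)
Definition can_sample_unsafe (R : realType) (U : set V) (N : nat)
    (tau : 'I_N.+1 -> T) (cost : ('I_N.+1 -> X) -> R) (xi : 'I_N.+1 -> X)
    (k M : nat) : Prop :=
  exists xi' : 'I_N.+1 -> X,
    [/\ feasible U tau xi',
        forall j, (forall i, (2 <= i <= M.-1)%N -> j <> block_index N k i) ->
          xi' j = xi j
      & cost xi' < cost xi].

Lemma lower_cost_unsafe (R : realType) (U : set V) (A : set X) (N : nat)
    (tau : 'I_N.+1 -> T) (x_start x_goal : X) (cost : ('I_N.+1 -> X) -> R)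
    (xi xi' : 'I_N.+1 -> X) :
  demonstration U A tau x_start x_goal cost xi ->
  known_constraints U tau x_start x_goal xi' -> cost xi' < cost xi ->
  exists j, A (xi' j).
Proof.
move=> [_ _ xi_min] kc' lt_cost; apply/not_existsP => safe'.
by have := xi_min xi' kc' safe'; rewrite leNgt lt_cost.
Qed.

End Systems.

(* Main.v *)
Require Import Defs.
From mathcomp Require Import all_boot all_order all_algebra.
From mathcomp Require Import boolp classical_sets reals.

Set Implicit Arguments.
Unset Strict Implicit.
Unset Printing Implicit Defensive.

Import Order.TTheory GRing.Theory Num.Theory.
Local Open Scope classical_set_scope.
Local Open Scope ring_scope.

(** The required states are the waypoints, inside the block, of the cheaper sampled trajectory. A
    single control drives that whole trajectory, so by the composition law of transitions it also
    steers each waypoint to the next ([feasible_FRS]). The ends of the block are not free, hence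
    unchanged. If no free waypoint had moved either, the two trajectories would coincide, and a cost
    cannot be strictly below itself. *)

Lemma block_indexE (N k M i : nat) :
  (k + M <= N.+1)%N -> (1 <= i <= M)%N ->
  block_index N k i = (k + i.-1)%N :> nat.
Proof.
move=> le_kM /andP[i_gt0 le_iM]; rewrite inordK //; apply: leq_trans le_kM.
by rewrite ltn_add2l prednK.
Qed.

(** This separates the ends of the block from its free positions. The bound by [N.+1] keeps [inord]
    off its default value, and positivity of [i] and [j] makes [.-1] injective. *)
Lemma block_index_inj (N k M i j : nat) :
  (k + M <= N.+1)%N -> (1 <= i <= M)%N -> (1 <= j <= M)%N ->
  block_index N k i = block_index N k j -> i = j.
Proof.
move=> le_kM iM jM /(congr1 val) /=; rewrite !(block_indexE le_kM) //.
move/addnI/(congr1 S); case/andP: iM => i_gt0 _; case/andP: jM => j_gt0 _.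
by rewrite !prednK.
Qed.

Lemma feasible_FRS (T : realDomainType) (X V : Type)
    (Sigma : control_system T X V) (U : set V) (N : nat) (tau : 'I_N.+1 -> T)
    (xi : 'I_N.+1 -> X) (a b : 'I_N.+1) :
  {homo tau : i j / (i <= j)%N >-> i <= j} ->
  feasible Sigma U tau xi -> (a <= b)%N ->
  FRS Sigma (xi a) U (tau a) (tau b) (xi b).
Proof.
move=> tau_le [u [uU ux]] le_ab.
have tau0_le : tau ord0 <= tau a by apply: tau_le.
exists u; split=> [s /andP[le_as le_sb]|].
  apply: uU; rewrite (le_trans tau0_le le_as) /=.
  by apply: le_trans le_sb _; apply: tau_le; apply: leq_ord.
(* Cut the run from [tau ord0] to [tau b] at time [tau a], where its state is [xi a]. *)
have := ux b.
by rewrite (transition_trans _ _ _ tau0_le (tau_le _ _ le_ab)) ux.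
Qed.

Theorem theoremA2 (T : realDomainType) (R : realType) (X V : Type)
    (Sigma : control_system T X V) (U : set V) (A : set X)
    (N : nat) (tau : 'I_N.+1 -> T)
    (htau : forall i j : 'I_N.+1, (i < j)%N -> tau i < tau j)
    (x_start x_goal : X) (cost : ('I_N.+1 -> X) -> R) (xi : 'I_N.+1 -> X)
    (hdemo : demonstration Sigma U A tau x_start x_goal cost xi)
    (k M : nat) (hM : (2 <= M)%N) (hkM : (k + M <= N.+1)%N)
    (xstar : nat -> X) (t dt : nat -> T)
    (hxstar : forall i, (1 <= i <= M)%N -> xstar i = xi (block_index N k i))
    (ht : forall i, (1 <= i <= M)%N -> t i = tau (block_index N k i))
    (hdt : forall i, (1 <= i < M)%N -> t i.+1 = t i + dt i) :
  can_sample_unsafe Sigma U tau cost xi k M ->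
  exists x : nat -> X,
    [/\ x 1%N = xstar 1%N,
        x M = xstar M,
        forall i, (1 <= i < M)%N ->
          FRS Sigma (x i) U (t i) (t i + dt i) (x i.+1)
      & exists2 i, (2 <= i <= M.-1)%N & x i <> xstar i].
Proof.
move=> [xi' [feas' xi'E lt_cost]].
have tau_le : {homo tau : i j / (i <= j)%N >-> i <= j}.
  move=> i j; rewrite leq_eqVlt => /orP[/eqP/val_inj -> //|lt_ij].
  exact/ltW/htau.
have M_gt0 : (0 < M)%N by apply: ltnW.
(* To be applied at [i = 1] and [i = M]. *)
have fixed i : (1 <= i <= M)%N -> ~~ (2 <= i <= M.-1)%N ->
    xi' (block_index N k i) = xstar i.
  move=> iM not_free; rewrite hxstar //; apply: xi'E => j free_j.
  have jM : (1 <= j <= M)%N.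
    by case/andP: free_j => /ltnW -> /leq_trans -> //; apply: leq_pred.
  by move/(block_index_inj hkM iM jM) => eq_ij; rewrite eq_ij free_j in not_free.
exists (fun i => xi' (block_index N k i)); split.
- by apply: fixed; rewrite ?M_gt0.
- apply: fixed; rewrite ?M_gt0 ?leqnn //.
  by rewrite negb_and -!ltnNge ltn_predL M_gt0 orbT.
- move=> i /andP[i_gt0 lt_iM].
  have iM : (1 <= i <= M)%N by rewrite i_gt0 ltnW.
  (* Folding [t i + dt i] back into [t i.+1] makes both times values of [tau]. *)
  rewrite -hdt ?i_gt0 // !ht //; apply: feasible_FRS => //.
  by rewrite !(block_indexE hkM) // leq_add2l leq_pred.
- apply: contrapT => no_move; suff eq_xi : xi' = xi.
    by rewrite eq_xi ltxx in lt_cost.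
  apply/funext => j.
  (* At a free position equality comes from [no_move]; at any other, inside or outside the block,
     from [xi'E]. *)
  have [[i free_i ->]|not_free] :=
    pselect (exists2 i, (2 <= i <= M.-1)%N & j = block_index N k i).
    have iM : (1 <= i <= M)%N.
      by case/andP: free_i => /ltnW -> /leq_trans -> //; apply: leq_pred.
    by rewrite -hxstar //; apply: contrapT => ne_i; apply: no_move; exists i.
  by apply: xi'E => i free_i eq_j; apply: not_free; exists i.
Qed.
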